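(* Let $D=\operatorname{diag}(d_1,\dots,d_{n+1})$ be a diagonal matrix with $d_i>0$ for all $i$, and let $(t,x)\in\mathbb{R}\times\mathbb{R}^n$. Put $\hat d_i=d_i/d_1$ for $i=2,\dots,n+1$ and $\hat D=\operatorname{diag}(\hat d_2,\dots,\hat d_{n+1})\in\mathbb{R}^{n\times n}$. Let $P(t,x)$ denote the Euclidean projection of $(t,x)$ onto the rescaled second-order cone $D\mathcal{K}_{\mathrm{soc}}^{n+1}$. Then $P(t,x)$ is given as follows. 1. If $t\le 0$ and $\|\hat D x\|\le -t$, then $P(t,x)=(0,\mathbf{0})$. 2. If $\|\hat D^{-1}x\|\le t$, then $P(t,x)=(t,x)$. 3. If $t=0$ and $x\ne \mathbf{0}$, then $P(t,x)=\big(\|(\hat D+\hat D^{-1})^{-1}x\|,\ (I+\hat D^{-2})^{-1}x\big)$, where $I$ is the $n\times n$ identity matrix. 4. Otherwise, if $\|\hat D^{-1}x\|>t$, let $\lambda>0$ be the solution of the following univariate equation in $\lambda$ (with the accompanying sign condition): $$\sum_{i=1}^{n}\left(\frac{\hat d_{i+1}^{-1}}{1+2\lambda \hat d_{i+1}^{-2}}\,x_i\right)^2-\frac{t^2}{(1-2\lambda)^2}=0,\qquad \frac{t}{1-2\lambda}>0.$$ Then the projection is given by $$P(t,x)=\big((1-2\lambda)^{-1}t,\ (I+2\lambda\hat D^{-2})^{-1}x\big).$$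
   Context: $\|\cdot\|$ is the Euclidean norm. The second-order cone is $\mathcal{K}_{\mathrm{soc}}^{n+1}=\{(t,x): t\in\mathbb{R},\ x\in\mathbb{R}^n,\ \|x\|\le t\}$. For a diagonal matrix $D$ with positive diagonal entries and a cone $\mathcal{K}\subseteq\mathbb{R}^{n+1}$, the rescaled cone is $D\mathcal{K}=\{Dv: v\in\mathcal{K}\}$, i.e. $v\in D\mathcal{K}$ iff $D^{-1}v\in\mathcal{K}$. Here the first diagonal entry $d_1$ of $D$ scales the $t$-coordinate and $d_{i+1}$ scales $x_i$. The Euclidean projection of a point onto a nonempty closed convex set is the unique point of the set nearest to it in Euclidean norm. ''Otherwise'' in case 4 means that none of the hypotheses of cases 1, 2, 3 holds. *)

(* Defs.v *)
From mathcomp Require Import all_boot all_order all_algebra.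
From mathcomp Require Import all_classical all_reals.

Set Implicit Arguments.
Unset Strict Implicit.
Unset Printing Implicit Defensive.

Import Order.TTheory GRing.Theory Num.Theory.

Local Open Scope classical_set_scope.
Local Open Scope ring_scope.

(* Not the norm [`|x|] that MathComp-Analysis puts on matrices, which is the
   sup norm. *)
Definition enorm (R : realType) (n : nat) (x : 'cV[R]_n) : R :=
  Num.sqrt (\sum_(i < n) x i 0 ^+ 2).

(* The point (t, x) of R x R^n; its t-coordinate is the row [lshift n 0] and
   its coordinate x_i is the row [rshift 1 i]. *)
Definition tx (R : realType) (n : nat) (t : R) (x : 'cV[R]_n) : 'cV[R]_(1 + n) :=
  col_mx t%:M x.

Definition ksoc (R : realType) (n : nat) : set 'cV[R]_(1 + n) :=
  [set v | exists t x, v = tx t x /\ enorm x <= t].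

Definition rescaled (R : realType) (m : nat) (d : 'rV[R]_m) (K : set 'cV[R]_m) :
    set 'cV[R]_m :=
  [set diag_mx d *m v | v in K].

Definition nearest (R : realType) (m : nat) (C : set 'cV[R]_m) (p q : 'cV[R]_m) :
    Prop :=
  C q /\ forall v, C v -> enorm (p - q) <= enorm (p - v).

(* [unique] is Corelib's: q is a nearest point and every nearest point is q. *)
Definition is_proj (R : realType) (m : nat) (C : set 'cV[R]_m) (p q : 'cV[R]_m) :
    Prop :=
  unique (nearest C p) q.

Definition dhat (R : realType) (n : nat) (d : 'rV[R]_(1 + n)) : 'rV[R]_n :=
  \row_(i < n) (d 0 (rshift 1 i) / d 0 (lshift n 0)).

(* Since 0^-1 = 0, the sign condition excludes lam = 1/2. *)
Definition case4_sol (R : realType) (n : nat) (d : 'rV[R]_(1 + n)) (t : R)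
    (x : 'cV[R]_n) (lam : R) : Prop :=
  [/\ 0 < lam,
      \sum_(i < n) ((dhat d 0 i)^-1 / (1 + 2 * lam * (dhat d 0 i) ^- 2) * x i 0) ^+ 2
        - t ^+ 2 / (1 - 2 * lam) ^+ 2 = 0
    & 0 < t / (1 - 2 * lam)].

(* Main.v *)
(* A point q of a convex cone is the projection of p as soon as p - q lies in the
   polar cone and is orthogonal to q. The cone is [{(s, y) : |Dh^-1 y| <= s}], and
   Cauchy-Schwarz puts every (a, b) with [|Dh b| <= -a] in its polar; in each
   case the proposed point passes this test. In case 4, after clearing the factor
   that blows up at lam = 1/2, the equation reads
   [(1 - u)^2 * \sum_i (a_i / (1 + b_i u))^2 = t^2] on ]0, 1[, with u = 2 lam when
   t > 0 and u = 1 / (2 lam) when t < 0, and the failure of cases 1 and 2 is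
   exactly what the intermediate value theorem needs. The multiplier is unique
   because the projection is. *)
Require Import Defs.
From mathcomp Require Import all_boot all_order all_algebra.
From mathcomp Require Import all_classical all_reals.
From mathcomp Require Import topology normedtype realfun.
From mathcomp Require Import ring lra.

Set Implicit Arguments.
Unset Strict Implicit.
Unset Printing Implicit Defensive.

Import Order.TTheory GRing.Theory Num.Theory.
Import numFieldNormedType.Exports.

Local Open Scope classical_set_scope.
Local Open Scope ring_scope.

(** * Euclidean norm and inner products *)

Lemma enorm_ge0 (R : realType) n (x : 'cV[R]_n) : 0 <= enorm x.
Proof. exact: sqrtr_ge0. Qed.

Lemma sqr_enorm (R : realType) n (x : 'cV[R]_n) :
  enorm x ^+ 2 = \sum_(i < n) x i 0 ^+ 2.
Proof. by rewrite sqr_sqrtr // sumr_ge0 // => i _; rewrite sqr_ge0. Qed.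

Lemma enorm_eq0 (R : realType) n (x : 'cV[R]_n) : enorm x = 0 -> x = 0.
Proof.
move=> x0; have /eqP := sqr_enorm x.
rewrite x0 expr0n /= eq_sym psumr_eq0 => [/allP z|i _]; last exact: sqr_ge0.
apply/colP => i; rewrite mxE; apply/eqP.
by have := z i (mem_index_enum _); rewrite /= sqrf_eq0.
Qed.

Lemma enormZ (R : realType) m (a : R) (x : 'cV[R]_m) : 0 <= a -> enorm (a *: x) = a * enorm x.
Proof.
move=> a0; rewrite /enorm.
have -> : \sum_(i < m) (a *: x) i 0 ^+ 2 = a ^+ 2 * \sum_(i < m) x i 0 ^+ 2.
  by rewrite mulr_sumr; apply: eq_bigr => i _; rewrite mxE exprMn.
by rewrite sqrtrM ?sqr_ge0 // sqrtr_sqr ger0_norm.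
Qed.

Lemma le_enorm (R : realType) m n (x : 'cV[R]_m) (y : 'cV[R]_n) :
  (enorm x <= enorm y) = (enorm x ^+ 2 <= enorm y ^+ 2).
Proof. by rewrite ler_sqr // nnegrE enorm_ge0. Qed.

(** Expanding a nonnegative sum of squares leaves the desired difference times
    [2 * (enorm x * enorm y)]. Zero vectors are treated first so that this factor is positive and
    can be cancelled. *)
Lemma enorm_cauchy_schwarz (R : realType) n (x y : 'cV[R]_n) :
  \sum_(i < n) x i 0 * y i 0 <= enorm x * enorm y.
Proof.
have [/enorm_eq0 ->|x0] := eqVneq (enorm x) 0.
  by rewrite big1 ?mulr_ge0 ?enorm_ge0 // => i _; rewrite mxE mul0r.
have [/enorm_eq0 ->|y0] := eqVneq (enorm y) 0.
  by rewrite big1 ?mulr_ge0 ?enorm_ge0 // => i _; rewrite mxE mulr0.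
have xy0 : 0 < enorm x * enorm y by rewrite mulr_gt0 ?lt0r ?x0 ?y0 ?enorm_ge0.
have : 0 <= \sum_(i < n) (enorm y * x i 0 - enorm x * y i 0) ^+ 2.
  by apply: sumr_ge0 => i _; exact: sqr_ge0.
have -> : \sum_(i < n) (enorm y * x i 0 - enorm x * y i 0) ^+ 2
    = 2 * (enorm x * enorm y) * (enorm x * enorm y - \sum_(i < n) x i 0 * y i 0).
  transitivity (enorm y ^+ 2 * (\sum_(i < n) x i 0 ^+ 2)
     + enorm x ^+ 2 * (\sum_(i < n) y i 0 ^+ 2)
     - 2 * (enorm x * enorm y) * \sum_(i < n) x i 0 * y i 0).
    rewrite !mulr_sumr -big_split -sumrB; apply: eq_bigr => i _ /=; ring.
  rewrite -!sqr_enorm; ring.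
by rewrite pmulr_rge0 ?subr_ge0 // mulr_gt0.
Qed.

(** * Projection onto a set: uniqueness and a sufficient criterion *)

Lemma unique_proj (R : realType) m (C : set 'cV[R]_m) (p q q' : 'cV[R]_m) :
  is_proj C p q -> is_proj C p q' -> q = q'.
Proof. by move=> [_ uq] [Cq' _]; exact: uq. Qed.

(** The obtuse angle at [q] turns the expansion of [enorm (p - v) ^+ 2] around [q] into a
    Pythagorean inequality. Dropping [enorm (v - q) ^+ 2] from it gives minimality; keeping it
    forces any other minimizer to equal [q]. *)
Lemma is_proj_obtuse (R : realType) m (C : set 'cV[R]_m) (p q : 'cV[R]_m) :
  C q -> (forall v, C v -> \sum_(i < m) (p - q) i 0 * (v - q) i 0 <= 0) ->
  is_proj C p q.
Proof.
move=> Cq obt.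
have pyth v : C v -> enorm (p - q) ^+ 2 + enorm (v - q) ^+ 2 <= enorm (p - v) ^+ 2.
  move=> /obt le0; rewrite !sqr_enorm.
  have -> : \sum_(i < m) (p - v) i 0 ^+ 2 = \sum_(i < m) (p - q) i 0 ^+ 2
      + \sum_(i < m) (v - q) i 0 ^+ 2
      - 2 * \sum_(i < m) (p - q) i 0 * (v - q) i 0.
    rewrite mulr_sumr -big_split -sumrB; apply: eq_bigr => i _ /=.
    by rewrite !mxE; ring.
  lra.
split=> [|v [Cv minv]].
  split=> // v Cv; rewrite le_enorm.
  by have := pyth v Cv; have := sqr_ge0 (enorm (v - q)); lra.
have := minv _ Cq; rewrite le_enorm => le.
apply/eqP; rewrite eq_sym -subr_eq0; apply/eqP/enorm_eq0/eqP.
rewrite -sqrf_eq0 eq_le sqr_ge0 andbT.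
by have := pyth v Cv; lra.
Qed.

(** * Diagonal matrices and block vectors in coordinates *)

Lemma invmx_diag (F : fieldType) n (e : 'rV[F]_n) :
  (forall i, e 0 i != 0) -> invmx (diag_mx e) = diag_mx (\row_i (e 0 i)^-1).
Proof.
move=> e0.
have ee : diag_mx e *m diag_mx (\row_i (e 0 i)^-1) = 1%:M.
  apply/matrixP => i j; rewrite mul_diag_mx !mxE.
  by have [->|] := eqVneq i j; rewrite ?mulr1n ?mulfV // mulr0n mulr0.
have [eU _] := mulmx1_unit ee.
by rewrite -[RHS](mulKmx eU) ee mulmx1.
Qed.

Lemma diag_mulE (F : fieldType) n (e : 'rV[F]_n) (x : 'cV[F]_n) i :
  (diag_mx e *m x) i 0 = e 0 i * x i 0.
Proof. by rewrite mul_diag_mx mxE. Qed.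

Lemma invmx_diag_mulE (F : fieldType) n (e : 'rV[F]_n) (x : 'cV[F]_n) i :
  (forall i, e 0 i != 0) -> (invmx (diag_mx e) *m x) i 0 = (e 0 i)^-1 * x i 0.
Proof. by move=> e0; rewrite invmx_diag // diag_mulE mxE. Qed.

Lemma txB (R : realType) n (s t : R) (x y : 'cV[R]_n) :
  tx s x - tx t y = tx (s - t) (x - y).
Proof. by rewrite /tx opp_col_mx add_col_mx raddfB. Qed.

Lemma sum_tx (R : realType) n (s t : R) (x y : 'cV[R]_n) :
  \sum_(i < 1 + n) tx s x i 0 * tx t y i 0 = s * t + \sum_(i < n) x i 0 * y i 0.
Proof.
rewrite big_split_ord big_ord1 /tx !col_mxEu !mxE !mulr1n; congr (_ + _).
by apply: eq_bigr => i _; rewrite !col_mxEd.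
Qed.

(** Intermediate value theorem on [[0, 1]]: the left side is [\sum_i a i ^+ 2] at 0 and vanishes at
    1, and [0 <= b i] keeps the denominators positive. Strictness of the bounds on [c] excludes both
    endpoints. *)
Lemma exists_secular_root (R : realType) n (a b : 'I_n -> R) (c : R) :
  (forall i, 0 <= b i) -> 0 < c < \sum_(i < n) a i ^+ 2 ->
  exists2 u : R, 0 < u < 1 &
    (1 - u) ^+ 2 * \sum_(i < n) (a i / (1 + b i * u)) ^+ 2 = c.
Proof.
move=> b0 /andP[c0 ca].
pose f u : R := (1 - u) ^+ 2 * \sum_(i < n) (a i / (1 + b i * u)) ^+ 2.
have f0 : f 0 = \sum_(i < n) a i ^+ 2.
  rewrite /f subr0 expr1n mul1r; apply: eq_bigr => i _.
  by rewrite mulr0 addr0 divr1.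
have f1 : f 1 = 0 by rewrite /f subrr expr0n mul0r.
have fcont : {within `[0, 1], continuous f}.
  apply: continuous_in_subspaceT => u; rewrite inE /= in_itv /= => /andP[u0 _].
  apply: cvgM.
    by apply: cvgM; apply: cvgB; (exact: cvg_cst || exact: cvg_id).
  apply: cvg_big => [|i _]; first exact: add_continuous.
  have den : (a i / (1 + b i * v)) @[v --> u] --> a i / (1 + b i * u).
    apply: cvgM; first exact: cvg_cst.
    apply: cvgV; first by rewrite lt0r_neq0 // ltr_wpDr // mulr_ge0.
    apply: cvgD; first exact: cvg_cst.
    by apply: cvgM; [exact: cvg_cst|exact: cvg_id].
  exact: (cvgM den den).
have [||u] := @IVT R f 0 1 c _ fcont => //.
  by rewrite f0 f1 ge_min le_max (ltW c0) (ltW ca) orbT.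
rewrite in_itv /= => /andP[u0 u1] fu.
exists u => //; rewrite !lt_neqAle u0 u1 !andbT; apply/andP; split.
  by apply/eqP => u0'; move: fu; rewrite -u0' f0 => fu; rewrite fu ltxx in ca.
by apply/eqP => u1'; move: fu; rewrite u1' f1 => fu; rewrite fu ltxx in c0.
Qed.

(** * The rescaled cone and projections onto it *)

Section RescaledCone.
Variables (R : realType) (n : nat) (d : 'rV[R]_(1 + n)).
Hypothesis hd : forall i, 0 < d 0 i.
Let Dh : 'M[R]_n := diag_mx (dhat d).
Let C := rescaled d (@ksoc R n).

Lemma dhat_gt0 i : 0 < dhat d 0 i.
Proof. by rewrite mxE divr_gt0. Qed.

Lemma dhat_neq0 i : dhat d 0 i != 0.
Proof. by rewrite gt_eqF ?dhat_gt0. Qed.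

(** By homogeneity of the norm, [d1] can be factored out of the cone inequality, so only the ratios
    [dhat d] remain. *)
Lemma rescaledP (v : 'cV[R]_(1 + n)) :
  C v <-> exists t x, v = tx t x /\ enorm (invmx Dh *m x) <= t.
Proof.
set d1 : R := d 0 (lshift n 0); have d10 : 0 < d1 := hd _.
have scale t x : enorm (invmx Dh *m x) <= d1 * t <-> 
   enorm (d1^-1 *: (invmx Dh *m x)) <= t.
  by rewrite enormZ ?invr_ge0 ?(ltW d10) // ler_pdivrMl.
split=> [[_ [t [x [-> le]]] <-]|[t [x [-> le]]]].
  exists (d1 * t), (diag_mx (\row_i d 0 (rshift 1 i)) *m x); split.
    apply/colP => i; rewrite diag_mulE /tx.
    case: (split_ordP i) => j ->; rewrite ?col_mxEu ?col_mxEd.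
      by rewrite ord1 !mxE !mulr1n.
    by rewrite diag_mulE !mxE.
  apply/scale; congr (enorm _ <= _): le; apply/colP => i.
  rewrite mxE invmx_diag_mulE ?diag_mulE; last exact: dhat_neq0.
  by rewrite !mxE -/d1; field; rewrite !lt0r_neq0.
exists (tx (d1^-1 * t) (diag_mx (\row_i (d 0 (rshift 1 i))^-1) *m x)).
  exists (d1^-1 * t), (diag_mx (\row_i (d 0 (rshift 1 i))^-1) *m x).
  split=> //.
  have := le; rewrite -[t in X in X -> _](mulVKf (lt0r_neq0 d10)) scale.
  congr (enorm _ <= _); apply/colP => i.
  rewrite mxE invmx_diag_mulE ?diag_mulE; last exact: dhat_neq0.
  by rewrite !mxE -/d1; field; rewrite !lt0r_neq0.
apply/colP => i; rewrite diag_mulE /tx.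
case: (split_ordP i) => j ->; rewrite ?col_mxEu ?col_mxEd.
  by rewrite ord1 !mxE !mulr1n mulVKf // lt0r_neq0.
by rewrite diag_mulE !mxE mulVKf // lt0r_neq0.
Qed.

(* Moreau decomposition: [enorm (Dh *m b) <= - a] says that [(a, b)] lies in the
   polar of the cone. *)
Lemma is_proj_polar (a s : R) (b y : 'cV[R]_n) :
  enorm (invmx Dh *m y) <= s -> enorm (Dh *m b) <= - a ->
  a * s + \sum_(i < n) b i 0 * y i 0 = 0 ->
  is_proj C (tx (a + s) (b + y)) (tx s y).
Proof.
move=> ys ba orth; apply: is_proj_obtuse; first by apply/rescaledP; exists s, y.
move=> _ /rescaledP[u [z [-> zu]]].
rewrite !txB sum_tx !addrK.
(* Orthogonality of the residual to [(s, y)] reduces the obtuse-angle test to the polar inequality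
   at [(u, z)]. *)
have -> : a * (u - s) + \sum_(i < n) b i 0 * (z - y) i 0
  = (a * u + \sum_(i < n) b i 0 * z i 0)
    - (a * s + \sum_(i < n) b i 0 * y i 0).
  rewrite (eq_bigr (fun i => b i 0 * z i 0 - b i 0 * y i 0)) => [|i _].
    by rewrite sumrB; ring.
  by rewrite !mxE; ring.
rewrite orth subr0.
(* Inserting [Dh] and its inverse matches the two factors of Cauchy-Schwarz with the polar bound and
   the cone bound. *)
have -> : \sum_(i < n) b i 0 * z i 0
    = \sum_(i < n) (Dh *m b) i 0 * (invmx Dh *m z) i 0.
  apply: eq_bigr => i _; rewrite diag_mulE invmx_diag_mulE; last exact: dhat_neq0.
  by field; exact: dhat_neq0.
have := enorm_cauchy_schwarz (Dh *m b) (invmx Dh *m z).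
have : enorm (Dh *m b) * enorm (invmx Dh *m z) <= - a * u.
  by apply: ler_pM => //; exact: enorm_ge0.
lra.
Qed.

(* With multiplier [lam], the residual [(t, x) - (s, y)] is
   [2 * lam] times [(- s, Dh^-2 y)], an outer normal of the cone at [(s, y)]. *)
Lemma is_proj_kkt (t lam : R) (x : 'cV[R]_n) :
  let y := \col_i (x i 0 / (1 + 2 * lam / dhat d 0 i ^+ 2)) in
  let s := enorm (invmx Dh *m y) in
  0 <= lam -> s * (1 - 2 * lam) = t -> is_proj C (tx t x) (tx s y).
Proof.
move=> y s lam0 st.
have den0 i : 1 + 2 * lam / dhat d 0 i ^+ 2 != 0.
  by rewrite lt0r_neq0 // ltr_wpDr // divr_ge0 ?sqr_ge0 ?mulr_ge0.
(* This identity yields both the polar bound, with equality, and the orthogonality. *)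
have Dxy : Dh *m (x - y) = (2 * lam) *: (invmx Dh *m y).
  apply/colP => i; rewrite diag_mulE [RHS]mxE invmx_diag_mulE; last exact: dhat_neq0.
  rewrite [(x - y) i 0]mxE [(- y) i 0]mxE.
  have -> : x i 0 = (1 + 2 * lam / dhat d 0 i ^+ 2) * y i 0.
    by rewrite [y i 0]mxE mulrC divfK.
  by field; exact: dhat_neq0.
have -> : tx t x = tx (- (2 * lam * s) + s) ((x - y) + y).
  by rewrite subrK -st; congr tx; ring.
apply: is_proj_polar => //.
  by rewrite opprK Dxy enormZ // mulr_ge0.
have -> : \sum_(i < n) (x - y) i 0 * y i 0
   = \sum_(i < n) 2 * lam * (invmx Dh *m y) i 0 ^+ 2.
  apply: eq_bigr => i _.
  have /(congr1 (fun v : 'cV_n => v i 0)) := Dxy.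
  rewrite diag_mulE [RHS]mxE => e.
  rewrite expr2 mulrA -e invmx_diag_mulE; last exact: dhat_neq0.
  by field; exact: dhat_neq0.
by rewrite -mulr_sumr -sqr_enorm -/s; ring.
Qed.

(** Brings the matrix formulas of cases 3 ([c = 1]) and 4 ([c = 2 * lam]) to the coordinate form of
    [is_proj_kkt]. *)
Lemma invmx_shiftE (c : R) (x : 'cV[R]_n) : 0 <= c ->
  invmx (1%:M + c *: (invmx Dh ^+ 2)) *m x
  = \col_i (x i 0 / (1 + c / dhat d 0 i ^+ 2)).
Proof.
move=> c0; pose e : 'rV[R]_n := \row_i (1 + c / dhat d 0 i ^+ 2).
have -> : 1%:M + c *: (invmx Dh ^+ 2) = diag_mx e.
  rewrite invmx_diag => [|i]; last exact: dhat_neq0.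
  rewrite expr2 -[_ * _]/(_ *m _) mulmx_diag -diag_const_mx -linearZ -raddfD.
  by congr diag_mx; apply/rowP => i; rewrite !mxE expr2 !invfM.
apply/colP => i; rewrite invmx_diag_mulE => [|j]; last first.
  by rewrite mxE lt0r_neq0 // ltr_wpDr // divr_ge0 ?sqr_ge0.
by rewrite [e 0 i]mxE [RHS]mxE mulrC.
Qed.

(** The equation equates the squares of [enorm (invmx Dh *m y)] and [t / (1 - 2 * lam)]; the sign
    condition allows taking roots, which gives the hypothesis of [is_proj_kkt]. *)
Lemma case4_proj (t : R) (x : 'cV[R]_n) lam : case4_sol d t x lam ->
  is_proj C (tx t x) (tx ((1 - 2 * lam)^-1 * t)
                  (invmx (1%:M + (2 * lam) *: (invmx Dh ^+ 2)) *m x)).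
Proof.
move=> [lam0 /eqP]; rewrite subr_eq0 => /eqP eq st0.
rewrite invmx_shiftE ?mulr_ge0 ?(ltW lam0) //.
set y := \col_i _.
have s : enorm (invmx Dh *m y) = (1 - 2 * lam)^-1 * t.
  rewrite mulrC; apply/eqP; rewrite -(@eqrXn2 _ 2) ?enorm_ge0 ?(ltW st0) //.
  rewrite expr_div_n -eq sqr_enorm; apply/eqP; apply: eq_bigr => i _.
  rewrite invmx_diag_mulE; last exact: dhat_neq0.
  by rewrite [y i 0]mxE; congr (_ ^+ 2); ring.
rewrite -s; apply: is_proj_kkt => //; first exact: ltW.
(* If [1 - 2 * lam] were 0, the quotient would be 0 because [0^-1 = 0], against the sign
   condition. *)
rewrite s mulrC mulVKf //; apply: contraTneq st0 => ->.
by rewrite invr0 mulr0 ltxx.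
Qed.

(* [1 - 2 * lam] is read off the first coordinate of the projection. *)
Lemma case4_uniq (t : R) (x : 'cV[R]_n) lam lam' :
  case4_sol d t x lam -> case4_sol d t x lam' -> lam = lam'.
Proof.
move=> sol sol'; have := unique_proj (case4_proj sol) (case4_proj sol').
move/(congr1 (fun v : 'cV_(1 + n) => v (lshift n 0) 0)).
rewrite /tx !col_mxEu !mxE !mulr1n => e.
have t0 : t != 0.
  by case: sol => _ _; apply: contraTneq => ->; rewrite mul0r ltxx.
by have /invr_inj := mulIf t0 e; lra.
Qed.

(** Squaring the second hypothesis bounds [t ^+ 2] when [t > 0], and squaring the third does so when
    [t < 0]; each is the upper bound required by [exists_secular_root]. *)
Lemma case4_exists (t : R) (x : 'cV[R]_n) : t != 0 ->
  t < enorm (invmx Dh *m x) -> - t < enorm (Dh *m x) ->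
  exists lam, case4_sol d t x lam.
Proof.
move=> t0 tpos tneg.
have e0 i := dhat_neq0 i.
have e2 i : 0 < dhat d 0 i ^+ 2 by rewrite exprn_gt0 // dhat_gt0.
have [tgt|tle] := ltP 0 t.
  have [i||u /andP[u0 u1] eq] := @exists_secular_root _ _
      (fun i => (dhat d 0 i)^-1 * x i 0) (fun i => (dhat d 0 i) ^- 2) (t ^+ 2).
  - by rewrite invr_ge0 ltW.
  - rewrite exprn_gt0 //=.
    rewrite (_ : \sum_(i < n) _ = enorm (invmx Dh *m x) ^+ 2).
      by rewrite ltr_pXn2r // ?nnegrE ?enorm_ge0 // ltW.
    by rewrite sqr_enorm; apply: eq_bigr => i _; rewrite invmx_diag_mulE.
  have u1' : 1 - u != 0 by lra.
  exists (u / 2); rewrite /case4_sol.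
  have -> : 2 * (u / 2) = u by field.
  split; [lra| |by rewrite divr_gt0 //; lra].
  rewrite -eq mulrAC mulfV ?expf_neq0 // mul1r -sumrB big1 // => i _.
  by rewrite [u * _]mulrC; ring.
have tlt : t < 0 by rewrite lt_neqAle t0.
(* Here [lam > 1 / 2], and [u = 1 / (2 * lam)]. *)
have [i||u /andP[u0 u1] eq] := @exists_secular_root _ _
    (fun i => dhat d 0 i * x i 0) (fun i => dhat d 0 i ^+ 2) (t ^+ 2).
- exact: ltW.
- rewrite exprn_even_gt0 //= t0 /=.
  rewrite (_ : \sum_(i < n) _ = enorm (Dh *m x) ^+ 2).
    by rewrite -sqrrN ltr_pXn2r // ?nnegrE ?enorm_ge0 // oppr_ge0.
  by rewrite sqr_enorm; apply: eq_bigr => i _; rewrite diag_mulE.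
have u0' : u != 0 by rewrite lt0r_neq0.
have u1' : u - 1 != 0 by lra.
exists (u^-1 / 2); rewrite /case4_sol.
have -> : 2 * (u^-1 / 2) = u^-1 by field.
have den : 1 - u^-1 = (u - 1) / u by field.
split; first by rewrite divr_gt0 ?invr_gt0.
  (* The factor [u ^+ 2] released by [(1 - u^-1) ^+ 2] goes into the sum, since [e^-1 / (1 + u^-1 *
     e ^- 2) = u * e / (1 + e ^+ 2 * u)]. *)
  have -> : t ^+ 2 / (1 - u^-1) ^+ 2
      = u ^+ 2 * \sum_(i < n) (dhat d 0 i * x i 0 / (1 + dhat d 0 i ^+ 2 * u)) ^+ 2.
    by rewrite den -eq; field; rewrite u0' u1'.
  rewrite mulr_sumr -sumrB big1 // => i _.
  have ? : 1 + dhat d 0 i ^+ 2 * u != 0.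
    by rewrite lt0r_neq0 // addr_gt0 // mulr_gt0.
  have ? : u * dhat d 0 i ^+ 2 + 1 != 0 by rewrite addrC mulrC.
  by field; do ?[apply/andP; split].
by rewrite nmulr_rgt0 // invr_lt0 den nmulr_rlt0 ?invr_gt0 //; lra.
Qed.
End RescaledCone.

Theorem theorem1 (R : realType) (n : nat) (d : 'rV[R]_(1 + n)) (t : R)
    (x : 'cV[R]_n) (hd : forall i, 0 < d 0 i) :
  let Dh : 'M[R]_n := diag_mx (dhat d) in
  let P_is := is_proj (rescaled d (@ksoc R n)) (tx t x) in
  let H1 := t <= 0 /\ enorm (Dh *m x) <= - t in
  let H2 := enorm (invmx Dh *m x) <= t in
  let H3 := t = 0 /\ x <> 0 in
  [/\ H1 -> P_is (tx 0 0),
      H2 -> P_is (tx t x),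
      H3 -> P_is (tx (enorm (invmx (Dh + invmx Dh) *m x))
                     (invmx (1%:M + invmx Dh ^+ 2) *m x))
    & ~ H1 -> ~ H2 -> ~ H3 -> t < enorm (invmx Dh *m x) ->
      (exists! lam : R, case4_sol d t x lam) /\
      (forall lam : R, case4_sol d t x lam ->
         P_is (tx ((1 - 2 * lam)^-1 * t)
                  (invmx (1%:M + (2 * lam) *: (invmx Dh ^+ 2)) *m x)))].
Proof.
move=> Dh P_is H1 H2 H3.
have e0 i := dhat_neq0 hd i.
have enorm0 : enorm (0 : 'cV[R]_n) = 0.
  by rewrite /enorm big1 ?sqrtr0 // => i _; rewrite mxE expr0n.
split.
(* Here the residual is [(t, x)] itself, which lies in the polar cone. *)
- move=> [_ le]; rewrite /P_is -[t]addr0 -[x]addr0; apply: (is_proj_polar hd) => //.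
    by rewrite mulmx0 enorm0.
  by rewrite mulr0 add0r big1 // => i _; rewrite mxE mulr0.
- move=> le; have := @is_proj_polar _ _ _ hd 0 t 0 x le.
  rewrite mulmx0 enorm0 oppr0 mul0r !add0r; apply=> //.
  by rewrite big1 // => i _; rewrite mxE mul0r.
(* Case 3 is the multiplier [lam = 1 / 2], for which [s * (1 - 2 * lam) = t] holds with [t = 0]
   whatever [s] is. *)
- move=> [t0 _]; have two : 2 * 2^-1 = 1 :> R by rewrite divff ?pnatr_eq0.
  rewrite /P_is t0 -[invmx Dh ^+ 2]scale1r -[X in X *: _]two.
  rewrite (invmx_shiftE hd); last by rewrite two.
  set y := \col_i _.
  have -> : enorm (invmx (Dh + invmx Dh) *m x) = enorm (invmx Dh *m y).
    pose e : 'rV[R]_n := \row_i (dhat d 0 i + (dhat d 0 i)^-1).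
    have -> : Dh + invmx Dh = diag_mx e.
      rewrite invmx_diag -?raddfD //; congr diag_mx.
      by apply/rowP => i; rewrite !mxE.
    have ei i : dhat d 0 i + (dhat d 0 i)^-1 != 0.
      by rewrite lt0r_neq0 // addr_gt0 ?invr_gt0 ?(dhat_gt0 hd).
    have ei' i : dhat d 0 i ^+ 2 + 1 != 0.
      by rewrite lt0r_neq0 // ltr_wpDl ?sqr_ge0.
    congr enorm; apply/colP => i.
    rewrite !invmx_diag_mulE // => [|j]; last by rewrite mxE.
    rewrite [e 0 i]mxE [y i 0]mxE two.
    by field; rewrite e0 -?expr2 ?ei'.
  by apply: (is_proj_kkt hd); rewrite ?invr_ge0 // two subrr mulr0.
- move=> nH1 _ nH3 lt; split; last by move=> lam; exact: (case4_proj hd).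
  (* With [t = 0], a nonzero [x] falls under case 3 and [x = 0] under case 1. *)
  have t0 : t != 0.
    apply/eqP => t0; have [x0|/eqP x0] := eqVneq x 0; last by apply: nH3.
    by apply: nH1; rewrite /H1 t0 x0 mulmx0 enorm0 oppr0.
  (* The reverse inequality already forces [t <= 0], hence all of case 1. *)
  have tneg : - t < enorm (Dh *m x).
    rewrite ltNge; apply/negP => le; apply: nH1; split=> //.
    by have := enorm_ge0 (Dh *m x); lra.
  have [lam sol] := case4_exists hd t0 lt tneg.
  by exists lam; split=> // lam'; exact: (case4_uniq hd).
Qed.
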